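(* Let $W$, $V$ and $T$ be finite-dimensional real vector spaces related by a short exact sequence $0\to V\to W\xrightarrow{\pi}T\to0$, with $n=\dim T$, let $\omega$ be a non-vanishing $(k+1-r)$-horizontal $(k+1)$-form on $W$, where $1\le r\le k+1$ and $k+1-r\le n$, and let $\hat\omega$ be its symbol, which is a $\bigwedge^{k+1-r}T^*$-valued $r$-form on $V$. Suppose that $\omega$ is multilagrangian, with multilagrangian subspace $L$. Then $\hat\omega$ is polylagrangian, with polylagrangian subspace $L$, and $$\ker\omega\subset\ker\hat\omega .$$ If $\omega$ is multipresymplectic, then $\hat\omega$ is polypresymplectic, with $$\dim\ker\hat\omega-\dim\ker\omega\le1 .$$
   Context: Here $V$ is regarded as a subspace of $W$. A form $\alpha\in\bigwedge^mW^*$ is $(m-s)$-horizontal if $\mathrm i_{v_1}\cdots\mathrm i_{v_{s+1}}\alpha=0$ for all $v_1,\dots,v_{s+1}\in V$; the space of these is denoted $\bigwedge^m_sW^*$. For $\omega\in\bigwedge^{k+1}_rW^*$ let $\omega^\flat(w)=\mathrm i_w\omega$ and $\ker\omega=\ker\omega^\flat\subset W$. For a subspace $L\subset V$ let $L^\perp\subset W^*$ be its annihilator in $W^*$ and $\bigwedge^k_{r-1}L^\perp=\bigwedge^kL^\perp\cap\bigwedge^k_{r-1}W^*$. A non-vanishing $\omega\in\bigwedge^{k+1}_rW^*$ is multilagrangian of rank $N$ and horizontality degree $k+1-r$ if $V$ has a subspace $L$ of codimension $N$ in $V$ with $\omega^\flat(L)=\bigwedge^k_{r-1}L^\perp$ (a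 multilagrangian subspace). It is multipresymplectic if moreover $k=n$ and $r=2$. The symbol of $\omega\in\bigwedge^{k+1}_rW^*$ is the $\bigwedge^{k+1-r}T^*$-valued $r$-form $\hat\omega$ on $V$ given by $\hat\omega(v_1,\dots,v_r)(t_1,\dots,t_{k+1-r})=\omega(v_1,\dots,v_r,\mathfrak s(t_1),\dots,\mathfrak s(t_{k+1-r}))$ for any linear splitting $\mathfrak s:T\to W$ of $\pi$ (the result is independent of $\mathfrak s$). A non-vanishing $r$-form $\hat\omega\in\bigwedge^rV^*\otimes\hat T$ on $V$ with values in a finite-dimensional vector space $\hat T$ is polylagrangian of rank $N$ if $V$ has a subspace $L$ of codimension $N$ with $\hat\omega^\flat(L)=(\bigwedge^{r-1}L^\perp)\otimes\hat T$, where here $L^\perp\subset V^*$ is the annihilator in $V^*$ and $\hat\omega^\flat(v)=\mathrm i_v\hat\omega$ for $v\in V$; such an $L$ is a polylagrangian subspace; $\ker\hat\omega=\ker\hat\omega^\flat\subset V$. It is polypresymplectic if moreover $r=2$.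
   Formalization: That the symbol is non-vanishing (hence polylagrangian/polypresymplectic in full) is claimed only if r−1 ≤ N, as otherwise the symbol is 0; the inclusion ker ω ⊂ ker ω̂ is claimed only if k > 0 or n = 0, as it always fails for k = 0, n ≥ 1. *)

(* Defs.v *)
From HB Require Import structures.
From mathcomp Require Import all_boot all_order all_algebra.
From mathcomp Require Import boolp reals.

Set Implicit Arguments.
Unset Strict Implicit.
Unset Printing Implicit Defensive.

Import GRing.Theory.
Local Open Scope ring_scope.

Section Span.
Variables (K : fieldType) (E : vectType K).

Lemma vspan_ex (P : E -> Prop) :
  exists X : seq E, (forall x, x \in X -> P x) /\
                    (forall x, P x -> x \in <<X>>%VS).
Proof.
suff H m (X : seq E) : (\dim {:E} <= \dim <<X>> + m)%N ->
    (forall x, x \in X -> P x) ->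
    exists X : seq E, (forall x, x \in X -> P x) /\
                      (forall x, P x -> x \in <<X>>%VS).
  by apply: (H (\dim {:E}) [::]); rewrite ?leq_addl.
elim: m X => [|m IHm] X dX XP.
  exists X; split=> // x _.
  have /eqP -> : (<<X>> == fullv)%VS; last exact: memvf.
  by rewrite -(geq_leqif (dimv_leqif_eq (subvf _))) -[X in (_ <= X)%N]addn0.
have [cl|/existsNP [x /not_implyP [Px /negP xX]]] :=
  pselect (forall x, P x -> x \in <<X>>%VS); first by exists X.
apply: (IHm (x :: X)); last first.
  by move=> y; rewrite inE => /predU1P [-> //|/XP].
apply: leq_trans dX _; rewrite addnS -addSn leq_add2r.
rewrite span_cons (ltn_leqif (dimv_leqif_sup (addvSr _ _))).
apply: contra xX => /subvP; apply.
by rewrite (subvP (addvSl _ _)) ?memv_line.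
Qed.

(* The subspace generated by the vectors satisfying P. *)
Definition vspan (P : E -> Prop) : {vspace E} :=
  <<sval (cid (vspan_ex P))>>%VS.

Lemma mem_vspan (P : E -> Prop) x : P x -> x \in vspan P.
Proof. by rewrite /vspan; case: cid => X [? H] /=; apply: H. Qed.

Lemma vspan_subP (P : E -> Prop) (U : {vspace E}) :
  (forall x, P x -> x \in U) -> (vspan P <= U)%VS.
Proof.
rewrite /vspan; case: cid => X [XP _] /= PU.
by apply/span_subvP => x /XP /PU.
Qed.

Lemma vspan_closed (P : E -> Prop) :
  P 0 -> (forall a x y, P x -> P y -> P (a *: x + y)) ->
  forall x, x \in vspan P <-> P x.
Proof.
move=> P0 PD x; split; last exact: mem_vspan.
rewrite /vspan; case: cid => X [XP _] /= xX; rewrite (coord_span (X := in_tuple X) xX).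
apply: (big_ind P) => // [u v Pu Pv|i _].
  by rewrite -[u]scale1r; apply: PD.
by rewrite -[_ *: _]addr0; apply: PD => //; apply/XP/mem_nth.
Qed.

End Span.

Section Forms.
Variables (R : realType) (U M : vectType R).

(* m-linear maps U x ... x U -> M in curried form, so that for
   f : mform m.+1 the term f u is the contraction i_u f. *)
Fixpoint mform (m : nat) : vectType R :=
  if m is m'.+1 then ('Hom(U, mform m') : vectType R) else M.

(* f(x_1, ..., x_m); meant for size x = m. *)
Fixpoint mapp (m : nat) : mform m -> seq U -> M :=
  if m is m'.+1 then
    fun (f : 'Hom(U, mform m')) x => mapp (f (head 0 x)) (behead x)
  else fun f _ => f.

(* The m-linear map with values F (x_1, ..., x_m); junk if F is not
   m-linear, see mform_ofE. *)
Fixpoint mform_of (m : nat) (F : seq U -> M) : mform m :=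
  if m is m'.+1 return mform m then
    (linfun (fun u : U => mform_of m' (fun x => F (u :: x)))
       : 'Hom(U, mform m'))
  else F [::].

Definition multilin (m : nat) (F : seq U -> M) : Prop :=
  forall x y a u v, (size x + size y).+1 = m ->
    F (x ++ (a *: u + v) :: y) = a *: F (x ++ u :: y) + F (x ++ v :: y).

Lemma mapp_linear m x : linear (fun f : mform m => mapp f x).
Proof.
elim: m x => [//|m IHm] x a f g /=.
by rewrite add_lfunE scale_lfunE IHm.
Qed.

Lemma mapp_multilin m (f : mform m) : multilin m (mapp f).
Proof.
elim: m f => [//|m IHm] f [|u0 x] y a u v [] sz /=.
  by rewrite linearP mapp_linear.
by rewrite IHm.
Qed.

Lemma mform_ext m (f g : mform m) :
  (forall x, size x = m -> mapp f x = mapp g x) -> f = g.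
Proof.
elim: m f g => [|m IHm] f g; first by apply; exact: (erefl (size [::])).
move=> H; apply/lfunP => u; apply: IHm => x sx.
exact: (H (u :: x) (congr1 S sx)).
Qed.

Lemma mform_ofE m F x : multilin m F -> size x = m -> mapp (mform_of m F) x = F x.
Proof.
elim: m F x => [|m IHm] F x lF; first by move/size0nil->.
case: x => // u x [sx] /=.
have lc w : multilin m (fun x => F (w :: x)).
  by move=> y z a u' v sz; rewrite -!cat_cons lF //= addSn sz.
have lin : linear (fun u : U => mform_of m (fun x => F (u :: x))).
  move=> a v w; apply: mform_ext => y sy.
  by rewrite mapp_linear !IHm // (lF [::]) //= sy.
pose h : {linear U -> mform m} :=
  HB.pack (fun u : U => mform_of m (fun x => F (u :: x)))
    (GRing.isLinear.Build _ _ _ _ _ lin).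
by rewrite (lfunE h) /= IHm.
Qed.

(* f^flat : u |-> i_u f, with i_u f = 0 in degree 0. *)
Definition flat (m : nat) : mform m -> 'Hom(U, mform m.-1) :=
  if m is m'.+1 then fun f => f else fun=> 0.

Definition kerform (m : nat) (f : mform m) : {vspace U} := lker (flat f).

Definition alternating (m : nat) (f : mform m) : Prop :=
  forall x : m.-tuple U, ~~ uniq x -> mapp f x = 0.

(* \bigwedge^m U^* \otimes M *)
Definition altform (m : nat) : {vspace mform m} := vspan (@alternating m).

Lemma altformP m (f : mform m) : f \in altform m <-> alternating f.
Proof.
apply: vspan_closed => [x _|a g h ag ah x ux].
  have := mapp_linear x (-1) (0 : mform m) 0.
  by rewrite scaler0 addr0 scaleN1r addNr.
by rewrite mapp_linear ag // ah // scaler0 addr0.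
Qed.

(* (phi_1 /\ ... /\ phi_m) \otimes t *)
Definition wedget (m : nat) (phi : m.-tuple 'Hom(U, R^o)) (t : M) : mform m :=
  mform_of m (fun x =>
    \det (\matrix_(i < m, j < m) (tnth phi i (nth 0 x j) : R)) *: t).

Lemma wedgetE m (phi : m.-tuple 'Hom(U, R^o)) t (x : m.-tuple U) :
  mapp (wedget phi t) x =
  \det (\matrix_(i < m, j < m) (tnth phi i (tnth x j) : R)) *: t.
Proof.
rewrite mform_ofE ?size_tuple //; last first.
  move=> y z a u v sz.
  rewrite scalerA -scalerDl; congr (_ *: _).
  have hj : (size y < m)%N by rewrite -sz ltnS leq_addr.
  pose D w : 'M[R]_m := \matrix_(j, i) tnth phi i (nth 0 w j).
  have DE w : \matrix_(i, j) tnth phi i (nth 0 w j) = (D w)^T.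
    by apply/matrixP => i j; rewrite !mxE.
  rewrite !DE !det_tr -[\det (D (y ++ v :: z))]mul1r.
  apply: (@determinant_multilinear _ _ _ _ _ (Ordinal hj)).
  - apply/rowP => i; rewrite !mxE /= !nth_cat ltnn subnn /= linearP.
    by rewrite mul1r.
  - apply/matrixP => i j; rewrite !mxE /= !nth_cat.
    have := neq_lift (Ordinal hj) i; rewrite -val_eqE /= => ne.
    case: ltnP => // le; case E: (_ - _)%N => [|//].
    by move: ne; rewrite eqn_leq le -subn_eq0 E.
  - apply/matrixP => i j; rewrite !mxE /= !nth_cat.
    have := neq_lift (Ordinal hj) i; rewrite -val_eqE /= => ne.
    case: ltnP => // le; case E: (_ - _)%N => [|//].
    by move: ne; rewrite eqn_leq le -subn_eq0 E.
by congr (\det _ *: _); apply/matrixP => i j; rewrite !mxE (tnth_nth 0 x).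
Qed.

(* (\bigwedge^m A) \otimes M for A a subspace of U^*;
   it is \bigwedge^m A when M = R. *)
Definition ext (m : nat) (A : {vspace 'Hom(U, R^o)}) : {vspace mform m} :=
  vspan (fun f => exists (phi : m.-tuple 'Hom(U, R^o)) (t : M),
    (forall i, tnth phi i \in A) /\ f = wedget phi t).

(* i_{v_1} ... i_{v_s} f = 0 for all v_1, ..., v_s in V *)
Fixpoint contr0 (V : {vspace U}) (s m : nat) (f : mform m) : Prop :=
  if s is s'.+1 then forall v, v \in V -> contr0 V s' (flat f v) else f = 0.

(* \bigwedge^m_s : the alternating (m-s)-horizontal forms *)
Definition horform (V : {vspace U}) (m s : nat) : {vspace mform m} :=
  vspan (fun f => alternating f /\ contr0 V s.+1 f).

Lemma horformP V m s (f : mform m) :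
  f \in horform V m s <-> alternating f /\ contr0 V s.+1 f.
Proof.
have c0 q p : contr0 V q (0 : mform p).
  elim: q p => [//|q IH] p /= v _.
  suff -> : flat (0 : mform p) v = 0 by apply: IH.
  by case: p => [|p]; rewrite /= lfunE.
have flatP p a (g h : mform p) v :
    flat (a *: g + h) v = a *: flat g v + flat h v.
  case: p g h => [|p] g h /=; first by rewrite !lfunE /= scaler0 addr0.
  by rewrite add_lfunE scale_lfunE.
have cl q p a (g h : mform p) :
    contr0 V q g -> contr0 V q h -> contr0 V q (a *: g + h).
  elim: q p g h => [|q IH] p g h /=; first by move=> -> ->; rewrite scaler0 addr0.
  by move=> Hg Hh v vV; rewrite flatP; apply: IH; [apply: Hg|apply: Hh].
apply: vspan_closed => [|a g h [ag cg] [ah ch]].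
  by split; [apply/altformP; rewrite mem0v|apply: c0].
split; last exact: cl.
by apply/altformP/rpredD; [apply: rpredZ|]; apply/altformP.
Qed.

End Forms.

Definition annihilator (R : realType) (U : vectType R) (L : {vspace U}) :
    {vspace 'Hom(U, R^o)} :=
  vspan (fun phi => (L <= lker phi)%VS).

Lemma annihilatorP (R : realType) (U : vectType R) (L : {vspace U})
    (phi : 'Hom(U, R^o)) :
  phi \in annihilator L <-> (L <= lker phi)%VS.
Proof.
apply: vspan_closed => [|a f g /subvP Lf /subvP Lg].
  by apply/subvP => x _; rewrite memv_ker lfunE.
apply/subvP => x xL; rewrite memv_ker add_lfunE scale_lfunE.
have := Lf _ xL; have := Lg _ xL; rewrite !memv_ker => /eqP -> /eqP ->.
by rewrite scaler0 addr0.
Qed.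

Definition short_exact (R : realType) (V W T : vectType R)
    (iota : 'Hom(V, W)) (prj : 'Hom(W, T)) : Prop :=
  [/\ lker iota = 0%VS, limg iota = lker prj & limg prj = fullv].


Section Symbol.
Variables (R : realType) (V W T : vectType R).
Variables (iota : 'Hom(V, W)) (s : 'Hom(T, W)) (k r : nat).

Definition symbol_type : vectType R :=
  mform V (subvs_of (altform T R^o (k.+1 - r))) r.

(* The symbol of omega computed with the splitting s. *)
Definition symbol (omega : mform W R^o k.+1) : symbol_type :=
  mform_of r (fun x => vsproj (altform T R^o (k.+1 - r))
    (mform_of (k.+1 - r) (fun y => mapp omega (map iota x ++ map s y)))).

Lemma symbolE (omega : mform W R^o k.+1) (x : r.-tuple V)
    (y : (k.+1 - r).-tuple T) : (r <= k.+1)%N -> alternating omega ->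
  mapp (vsval (mapp (symbol omega) x)) y = mapp omega (map iota x ++ map s y).
Proof.
move=> rk aw.
have lin2 z : size z = r ->
    multilin (k.+1 - r) (fun y => mapp omega (map iota z ++ map s y)).
  move=> sz x' y' a u v sxy; rewrite !map_cat !map_cons linearP !catA mapp_multilin //.
  by rewrite size_cat !size_map sz -addnA -addnS sxy subnKC.
have alt2 z : size z = r ->
    mform_of (k.+1 - r) (fun y => mapp omega (map iota z ++ map s y))
      \in altform T R^o (k.+1 - r).
  move=> sz; apply/altformP => y' uy.
  rewrite mform_ofE ?size_tuple //; last exact: lin2.
  have st : size (map iota z ++ map s y') == k.+1.
    by rewrite size_cat !size_map sz size_tuple subnKC.
  apply: (aw (Tuple st)) => /=.
  by rewrite cat_uniq; apply: contra uy => /and3P [_ _ /map_uniq].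
rewrite mform_ofE ?size_tuple //.
  by rewrite vsprojK ?alt2 ?size_tuple // mform_ofE ?size_tuple //; apply: lin2;
     rewrite size_tuple.
move=> x' y' a u v sxy; rewrite -linearP; congr (vsproj _ _).
have sz w : size (x' ++ w :: y') = r by rewrite size_cat /= addnS.
apply: mform_ext => z sz'.
rewrite mapp_linear !mform_ofE //; try exact: lin2.
rewrite !map_cat !map_cons linearP -!catA !cat_cons mapp_multilin //.
by rewrite size_cat !size_map sz' addnA -addSn sxy subnKC.
Qed.

End Symbol.

Section Multilagrangian.
Variables (R : realType) (V W : vectType R) (iota : 'Hom(V, W)).
Variables (k r : nat) (omega : mform W R^o k.+1) (N : nat).

(* L has codimension N in V, and omega^flat(L) = \bigwedge^k_{r-1} L^perp. *)
Definition multilagrangian_subspace (L : {vspace V}) : Prop :=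
  (\dim L + N)%N = \dim {:V} /\
  (flat omega @: (iota @: L))%VS =
    (ext R^o k (annihilator (iota @: L)) :&: horform R^o (limg iota) k r.-1)%VS.

Definition multilagrangian : Prop :=
  [/\ omega \in horform R^o (limg iota) k.+1 r, omega != 0 &
      exists L, multilagrangian_subspace L].

Definition multipresymplectic (n : nat) : Prop :=
  [/\ multilagrangian, k = n & r = 2].

End Multilagrangian.

Section Polylagrangian.
Variables (R : realType) (V M : vectType R).
Variables (r : nat) (tau : mform V M r) (N : nat).

Definition polylagrangian_subspace (L : {vspace V}) : Prop :=
  (\dim L + N)%N = \dim {:V} /\
  (flat tau @: L)%VS = ext M r.-1 (annihilator L).

Definition polylagrangian : Prop :=
  [/\ tau \in altform V M r, tau != 0 & exists L, polylagrangian_subspace L].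

Definition polypresymplectic : Prop := polylagrangian /\ r = 2.

End Polylagrangian.

(* Main.v *)
(** An alternating form lies in the exterior algebra of the annihilator of [L]
   exactly when its contractions with [L] vanish.  Hence contracting the symbol
   with [L] lands in the right space, and conversely
   [phi_1 /\ .. /\ phi_(r-1) (x) (theta_1 /\ .. /\ theta_(k+1-r))] lifts to the
   [k]-form [(phi o rho) /\ (theta o pi)] on [W], [rho] being the retraction of
   [W] onto [V] along the splitting; this form is [i_v omega] for some [v] in
   [L], and then [i_v omegahat] is the given element.
   If [w] in the kernel of [omega] were not vertical, such a [k]-form not
   annihilated by [i_w] would be [i_v omega] with [v] in [L], contradicting
   [i_w i_v omega = 0].  In the multipresymplectic case, [v] in the kernel of
   [omegahat] makes [i_v omega] the pullback of an [n]-form on [T], so the kernel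
   of [omega] is cut out of the kernel of [omegahat] by one linear equation. *)
Require Import Defs.
From HB Require Import structures.
From mathcomp Require Import all_boot all_order all_algebra.
From mathcomp Require Import boolp reals.
Import GRing.Theory.
Local Open Scope ring_scope.

Set Implicit Arguments.
Unset Strict Implicit.
Unset Printing Implicit Defensive.

(** * Induction over spans, block determinants *)

Lemma vspan_ind (K : fieldType) (E : vectType K) (P Q : E -> Prop) :
  Q 0 -> (forall a x y, Q x -> Q y -> Q (a *: x + y)) ->
  (forall x, P x -> Q x) -> forall x, x \in vspan P -> Q x.
Proof.
(* [Q] cuts out a subspace, namely [vspan Q], and it contains the generators. *)
move=> Q0 QD PQ x xP; apply/(vspan_closed Q0 QD).
by move: x xP; apply/subvP/vspan_subP => y /PQ; apply: mem_vspan.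
Qed.

(** Entries are indexed by natural numbers, so that values of concatenated covectors on concatenated
    arguments fit without casting ordinals. *)
Lemma det_ublock_fun (R : comPzRingType) (a b : nat) (F : nat -> nat -> R) :
  (forall i j, (a <= i < a + b)%N -> (j < a)%N -> F i j = 0) ->
  \det (\matrix_(i < a + b, j < a + b) F i j) =
  \det (\matrix_(i < a, j < a) F i j) *
  \det (\matrix_(i < b, j < b) F (a + i)%N (a + j)%N).
Proof.
move=> F0; pose B := \matrix_(i < a, j < b) F i (a + j)%N.
rewrite -(det_ublock _ B); congr (\det _).
apply/matrixP => i j; rewrite -(splitK i) -(splitK j).
case: (split i) => i'; case: (split j) => j' /=.
- by rewrite block_mxEul !mxE.
- by rewrite block_mxEur !mxE.
- by rewrite block_mxEdl !mxE F0 //= leq_addr ltn_add2l ltn_ord.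
- by rewrite block_mxEdr !mxE.
Qed.

Lemma det_col0 (R : comPzRingType) (m : nat) (A : 'M[R]_m) j :
  (forall i, A i j = 0) -> \det A = 0.
Proof.
by move=> A0; rewrite (expand_det_col _ j) big1 // => i _; rewrite A0 mul0r.
Qed.

Lemma linear_fun0 (R : pzRingType) (E F : lmodType R) (h : E -> F) :
  linear h -> h 0 = 0.
Proof. by move=> /(_ (-1) 0 0); rewrite scaler0 addr0 scaleN1r addNr. Qed.

(** * Alternating forms and the exterior algebra of an annihilator *)

Section Alternating.
Variables (R : realType) (U M : vectType R).
Implicit Types (L : {vspace U}).

Lemma mapp0 m x : mapp (0 : mform U M m) x = 0.
Proof. exact: (linear_fun0 (@mapp_linear _ _ _ _ x)). Qed.

Lemma mappZ m (f : mform U M m) a x : mapp (a *: f) x = a *: mapp f x.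
Proof. by rewrite -[a *: f]addr0 mapp_linear mapp0 addr0. Qed.

Lemma flat_linear m v : linear (fun f : mform U M m => flat f v).
Proof.
move=> a f g; case: m f g => [|m] f g /=; first by rewrite !lfunE /= scaler0 addr0.
by rewrite add_lfunE scale_lfunE.
Qed.

Lemma wedget_nthE m (phi : m.-tuple 'Hom(U, R^o)) (t : M) x : size x = m ->
  mapp (wedget phi t) x =
  \det (\matrix_(i < m, j < m) (nth 0 phi i (nth 0 x j) : R)) *: t.
Proof.
move=> /eqP sx; rewrite (wedgetE phi t (Tuple sx)).
by congr (\det _ *: _); apply/matrixP => i j; rewrite !mxE !(tnth_nth 0).
Qed.

Lemma wedget_linear m (phi : m.-tuple 'Hom(U, R^o)) :
  linear (fun t : M => wedget phi t).
Proof.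
move=> a t t'; apply: mform_ext => x sx.
by rewrite mapp_linear !wedget_nthE // scalerDr !scalerA mulrC.
Qed.

(** In degree 0 [flat] is zero, so every constant is killed, in accordance with the empty wedges. *)
Definition killed L m (f : mform U M m) := forall u, u \in L -> flat f u = 0.

Lemma alternating_nuniq m (f : mform U M m) x :
  alternating f -> size x = m -> ~~ uniq x -> mapp f x = 0.
Proof. by move=> af /eqP sx; apply: (af (Tuple sx)). Qed.

Lemma alternating_flat m (f : mform U M m.+1) u :
  alternating f -> alternating (f u : mform U M m).
Proof.
move=> af x ux; apply: (alternating_nuniq (x := u :: x) af).
  by rewrite /= size_tuple.
by rewrite /= negb_and ux orbT.
Qed.

(** A contraction only sees the first slot. Expanding [f] at two equal arguments [w + u] gives the
    sign change that brings [u] there. *)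
Lemma mapp_killed L m (f : mform U M m) x u y : alternating f -> killed L f ->
  (size x + size y).+1 = m -> u \in L -> mapp f (x ++ u :: y) = 0.
Proof.
case: x => [|w x] af kf sm uL.
  by case: m f sm af kf => // m f _ _ /(_ u uL) /= ->; rewrite mapp0.
have Z v : mapp f (v :: x ++ v :: y) = 0.
  apply: alternating_nuniq => //; first by rewrite -sm /= size_cat /= addnS.
  by rewrite /= mem_cat inE eqxx orbT.
have := Z (w + u).
have := @mapp_multilin _ _ _ _ f nil (x ++ (w + u) :: y) 1 w u.
rewrite !scale1r /= => ->; last by rewrite size_cat -sm /= addnS.
have L2 v : mapp f (v :: x ++ (w + u) :: y) = mapp f (v :: x ++ w :: y) + mapp f (v :: x ++ u :: y).
  by have := @mapp_multilin _ _ _ _ f (v :: x) y 1 w u; rewrite !scale1r; apply.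
rewrite !L2 !Z add0r addr0.
suff -> : mapp f (u :: x ++ w :: y) = 0 by rewrite addr0.
by case: m f sm af kf {Z L2} => // m f _ _ /(_ u uL) /= ->; rewrite mapp0.
Qed.

(** On a wedge, a repeated argument gives two equal columns of the determinant, and a first argument
    in [L] gives a zero column. *)
Lemma ext_killed m L (f : mform U M m) :
  f \in ext M m (annihilator L) -> alternating f /\ killed L f.
Proof.
move: f; apply: vspan_ind => [|a f g [af kf] [ag kg]|_ [phi [t [phiL ->]]]].
- split; first by apply/altformP; rewrite mem0v.
  by move=> u _; apply: (linear_fun0 (@flat_linear m u)).
- split; first by apply/altformP/rpredD; [apply: rpredZ|]; apply/altformP.
  by move=> u uL; rewrite flat_linear kf ?kg // scaler0 addr0.
split.
  move=> x /(uniqPn 0) [i [j [ij jx E]]]; rewrite wedget_nthE ?size_tuple //.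
  rewrite size_tuple in jx; have im := ltn_trans ij jx.
  rewrite -det_tr (@determinant_alternate _ _ _ (Ordinal im) (Ordinal jx)) ?scale0r //.
    by rewrite -val_eqE /= neq_ltn ij.
  by move=> l; rewrite !mxE /= E.
case: m phi phiL => [|m] phi phiL u uL; first by rewrite /= lfunE.
apply: mform_ext => x sx; rewrite mapp0.
have -> : mapp (flat (wedget phi t) u) x = mapp (wedget phi t) (u :: x) by [].
rewrite wedget_nthE /= ?sx // (det_col0 (j := ord0)) ?scale0r // => i.
rewrite mxE /= -tnth_nth; have /annihilatorP /subvP := phiL i.
by move=> /(_ u uL); rewrite memv_ker => /eqP.
Qed.

Lemma annihilatorS L L' : (L <= L')%VS -> (annihilator L' <= annihilator L)%VS.
Proof.
move=> LL'; apply/subvP => phi /annihilatorP L'phi; apply/annihilatorP.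
exact: subv_trans L'phi.
Qed.

Lemma extS m A B : (A <= B)%VS -> (ext M m A <= @ext R U M m B)%VS.
Proof.
move=> /subvP AB; apply: vspan_subP => f [phi [t [phiA ->]]].
by apply: mem_vspan; exists phi, t; split=> // i; apply: AB.
Qed.

(** The covectors are the coordinates along [x] of the projection onto the span of [x] parallel to
    [L]. *)
Lemma dual_tuple m (x : m.-tuple U) L : free x -> (L :&: <<x>> = 0)%VS ->
  exists phi : m.-tuple 'Hom(U, R^o),
    (forall i, tnth phi i \in annihilator L) /\
    (forall i j, tnth phi i (tnth x j) = (i == j)%:R).
Proof.
move=> fx Lx; have xL : (<<x>> :&: L = 0)%VS by rewrite capvC.
exists [tuple (linfun (coord x i : U -> R^o) \o daddv_pi <<x>> L)%VF | i < m].
split=> i => [|j]; rewrite tnth_mktuple.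
  apply/annihilatorP/subvP => u uL; rewrite memv_ker comp_lfunE.
  have := @daddv_pi_add _ _ <<x>>%VS L u xL; rewrite (daddv_pi_id Lx uL).
  move=> /(_ (subvP (addvSr _ _) _ uL)) /(canRL (addrK _)) ->.
  by rewrite subrr linear0.
rewrite comp_lfunE lfunE /= daddv_pi_id ?memv_span ?mem_tnth //.
by rewrite (tnth_nth 0) coord_free // eq_sym.
Qed.

(* Induction on the codimension of L: for e outside L and a covector e^* in the
   annihilator of L with e^* e = 1, the form f - e^* /\ i_e f is killed by L + <[e]>. *)
Lemma killed_ext m L (f : mform U M m) :
  alternating f -> killed L f -> f \in ext M m (annihilator L).
Proof.
have [c Hc] : exists c, (\dim {:U} <= \dim L + c)%N.
  by exists (\dim {:U}); apply: leq_addl.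
elim: c m L f Hc => [|c IH] [|m] L f Hc af kf.
(* In degree 0 the form is the empty wedge with coefficient [f]; in positive degree with no
   codimension left, [L] is everything. *)
1,3: apply: mem_vspan; exists [tuple], f; split=> [[]//|];
     by apply: mform_ext => x sx; rewrite wedget_nthE // det_mx00 scale1r.
  suff -> : f = 0 by apply: mem0v.
  have /eqP EL : (L == fullv)%VS.
    by rewrite -(geq_leqif (dimv_leqif_eq (subvf _))) -[X in (_ <= X)%N]addn0.
  by apply/lfunP => u; rewrite lfunE /=; apply: kf; rewrite EL memvf.
have [EL|/subvPn [e _ eL]] := boolP (fullv <= L)%VS.
  suff -> : f = 0 by apply: mem0v.
  by apply/lfunP => u; rewrite lfunE /=; apply: kf; rewrite (subvP EL) ?memvf.
have e0 : e != 0 by apply: contraNneq eL => ->; apply: mem0v.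
have Le : (L :&: <<[tuple e]>> = 0)%VS.
  apply/eqP; rewrite -subv0; apply/subvP => x; rewrite memv_cap span_seq1.
  case/andP => xL /vlineP [a xE]; rewrite xE memv0 scaler_eq0 (negPf e0) orbF.
  apply: contraNT eL => a0.
  by rewrite -[e](scalerK a0) -xE memvZ.
have [|phi0s [/(_ ord0) phi0L /(_ ord0 ord0)]] := dual_tuple _ Le.
  by rewrite seq1_free.
rewrite (tnth_nth 0 [tuple e]) /= => phi0e; set phi0 := tnth phi0s _ in phi0L phi0e.
pose L' := (L + <[e]>)%VS.
have LL' : (L <= L')%VS by apply: addvSl.
have eL' : e \in L' by rewrite (subvP (addvSr _ _)) ?memv_line.
(* The lift of [h] is [phi0] wedge [h]: covectors in the annihilator of [L'] vanish on [e] and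
   [phi0 e = 1], so the column of [e] is the first unit vector. *)
have G h : h \in ext M m (annihilator L') ->
    exists g : mform U M m.+1, g \in ext M m.+1 (annihilator L) /\ flat g e = h.
  move: h; apply: vspan_ind => [|a _ _ [g [gL <-]] [g' [g'L <-]]|].
  - by exists 0; rewrite mem0v /= lfunE.
  - exists (a *: g + g'); split; first by rewrite rpredD ?rpredZ.
    exact: (flat_linear e a g g').
  move=> _ [phi [t [phiL ->]]]; exists (wedget [tuple of phi0 :: phi] t); split.
    apply: mem_vspan; exists [tuple of phi0 :: phi], t; split=> // i.
    have [j|] := unliftP ord0 i => [->|->]; last by rewrite tnth0.
    by rewrite tnthS; apply: (subvP (annihilatorS LL')).
  apply: mform_ext => x sx.
  have -> : mapp (flat (wedget [tuple of phi0 :: phi] t) e) x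
    = mapp (wedget [tuple of phi0 :: phi] t) (e :: x) by [].
  rewrite !wedget_nthE ?[size _]/= ?sx //.
  rewrite (@det_ublock_fun _ 1 m (fun i j => nth 0 (phi0 :: phi) i (nth 0 (e :: x) j))).
    by rewrite det_mx11 mxE /= phi0e mul1r.
  case=> [//|i] [|//] /=; rewrite !ltnS => im _.
  have /annihilatorP /subvP := phiL (Ordinal im).
  by rewrite (tnth_nth 0) => /(_ _ eL'); rewrite memv_ker => /eqP.
have dL' : (\dim {:U} <= \dim L' + c)%N.
  apply: leq_trans Hc _; rewrite addnS -addSn leq_add2r.
  rewrite (ltn_leqif (dimv_leqif_sup LL')).
  by apply: contra eL => /subvP; apply.
have [g [gL ge]] : exists g : mform U M m.+1,
    g \in ext M m.+1 (annihilator L) /\ flat g e = flat f e.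
  apply: G; apply: (IH) dL' _ _; first exact: alternating_flat.
  move=> u /memv_addP [v vL [w /vlineP [a ->] ->]].
  case: m f af kf {IH} => [|m] f af kf; first by rewrite /= lfunE.
  rewrite linearD linearZ /=; apply: mform_ext => x sx.
  rewrite mapp0 -[mapp _ _]/(mapp (f e v + a *: f e e) x) addrC mapp_linear.
  have /= -> := mapp_killed (x := [:: e]) (u := v) (y := x) af kf; rewrite ?sx //.
  rewrite addr0 (_ : mapp (f e e) x = 0) ?scaler0 //.
  apply: (alternating_nuniq (x := e :: e :: x) af); first by rewrite /= sx.
  by rewrite /= inE eqxx.
have [ag kg] := ext_killed gL.
rewrite -(subrK g f) rpredD //.
(* The difference [f - g] is killed by [L']; induction puts it in the smaller exterior algebra of
   the annihilator of [L']. *)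
have /subvP := @extS m.+1 _ _ (annihilatorS LL'); apply.
apply: (IH) dL' _ _; first by apply/altformP; rewrite rpredB //; apply/altformP.
move=> u /memv_addP [v vL [w /vlineP [a ->] ->]].
have FB x : flat (f - g) x = flat f x - flat g x.
  by have := flat_linear x (-1) g f; rewrite !scaleN1r ![- _ + _]addrC.
have -> : flat (f - g) (v + a *: e) = flat (f - g) v + a *: flat (f - g) e.
  by rewrite linearD linearZ.
by rewrite !FB ge kf // kg // !subrr scaler0 addr0.
Qed.

(** Modulo [L] the arguments are combinations of [e], so for a wedge this is multiplicativity of the
    determinant. Freeness of [e] is not asked for, which allows padding by zeros. *)
Lemma mapp_det L m (f : mform U M m) (e : m.-tuple U) x :
  (L + <<e>>)%VS = fullv -> f \in ext M m (annihilator L) -> size x = m ->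
  mapp f x = \det (\matrix_(i < m, j < m)
                     coord e i (addv_pi2 L <<e>> (nth 0 x j))) *: mapp f e.
Proof.
move=> Le fL sx; move: f fL; apply: vspan_ind => [|a f g IHf IHg|].
- by rewrite !mapp0 scaler0.
- by rewrite !mapp_linear IHf IHg scalerDr !scalerA mulrC.
move=> _ [phi [t [phiL ->]]]; rewrite !wedget_nthE ?size_tuple // scalerA.
congr (_ *: _); rewrite mulrC -det_mulmx; congr (\det _).
apply/matrixP => i j; rewrite !mxE; set v := nth 0 x j.
have vE := addv_pi1_pi2 (U := L) (V := <<e>>%VS) (w := v).
rewrite -{1}vE ?Le ?memvf // linearD /=.
have /annihilatorP /subvP /(_ _ (memv_pi1 L <<e>> v)) := phiL i.
rewrite memv_ker (tnth_nth 0) => /eqP ->; rewrite add0r.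
rewrite {1}(coord_span (memv_pi2 L <<e>> v)) linear_sum; apply: eq_bigr => l _.
by rewrite linearZ !mxE mulrC.
Qed.

Lemma alternating_eq0 L m (f : mform U M m) (e : m.-tuple U) :
  (L + <<e>>)%VS = fullv -> alternating f -> killed L f -> mapp f e = 0 -> f = 0.
Proof.
move=> Le af kf fe; apply: mform_ext => x sx; rewrite mapp0.
by rewrite (mapp_det Le) ?fe ?scaler0 //; apply: killed_ext.
Qed.

(** A basis of a complement of [L], padded by at least one zero vector to length [m], tests the
    form, and the value there is zero. *)
Lemma alternating_gt_codim L m (f : mform U M m) :
  (\dim {:U} < \dim L + m)%N -> alternating f -> killed L f -> f = 0.
Proof.
move=> dL af kf; pose b := vbasis L^C.
have sm : (\dim L^C < m)%N.
  by rewrite dimv_compl ltn_subLR ?dimvS ?subvf.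
have se : size (b ++ nseq (m - \dim L^C) 0) == m.
  by rewrite size_cat size_nseq size_tuple subnKC // ltnW.
apply: (alternating_eq0 (e := Tuple se)) (af) (kf) _.
  apply/eqP; rewrite eqEsubv subvf -(addv_complf L) addvS //= span_cat.
  by rewrite (span_basis (vbasisP _)) addvSl.
have [d dE] : exists d, (m - \dim L^C)%N = d.+1.
  by case: (m - _)%N (subn_gt0 (\dim L^C) m) => [|d _]; [rewrite sm | exists d].
rewrite /= dE /= (mapp_killed af kf) ?mem0v // size_nseq size_tuple.
by rewrite -addnS -dE subnKC // ltnW.
Qed.
End Alternating.

(** * Evaluating horizontal forms, forms on a quotient, and dual families *)

Lemma flat_eq0 (R : realType) (U M : vectType R) m (f : mform U M m) u :
  (forall x, (size x).+1 = m -> mapp f (u :: x) = 0) -> flat f u = 0.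
Proof.
case: m f => [|m] f f0; first by rewrite /= lfunE.
by apply: mform_ext => x sx; rewrite mapp0 -(f0 x) ?sx.
Qed.

Lemma contr0_mapp (R : realType) (U M : vectType R) (V : {vspace U}) s m
    (f : mform U M m) x y :
  contr0 V s f -> {in x, forall v, v \in V} -> size x = s ->
  (size x + size y)%N = m -> mapp f (x ++ y) = 0.
Proof.
move=> cf xV sx; move: cf; rewrite -{}sx; elim: x m f xV => [|v x IH] m f xV.
  by move=> /= -> _; apply: mapp0.
case: m f => //= m f cf [sz]; apply: IH sz; last by apply: cf; apply: xV; rewrite inE eqxx.
by move=> u ux; apply: xV; rewrite inE ux orbT.
Qed.

Lemma mapp_contr0 (R : realType) (U M : vectType R) (V : {vspace U}) s m
    (f : mform U M m) :
  (forall x y, {in x, forall v, v \in V} -> size x = s ->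
     (size x + size y)%N = m -> mapp f (x ++ y) = 0) -> contr0 V s f.
Proof.
elim: s m f => [|s IH] m f f0 /=.
  by apply: mform_ext => x sx; rewrite mapp0; apply: (f0 [::]).
move=> v vV; apply: IH => x y xV sx; case: m f f0 => [|m] f f0 sz.
  by rewrite /= lfunE.
apply: (f0 (v :: x)) => [u||]; last 2 first.
- by rewrite /= sx.
- by rewrite /= addSn sz.
by rewrite inE => /predU1P [->|/xV].
Qed.

(** Such forms factor through the quotient by [L]; with [L] vertical, an argument [w] may be
    replaced by [s (prj w)]. *)
Lemma mapp_mod (R : realType) (U M : vectType R) (L : {vspace U}) m
    (f : mform U M m) x y :
  f \in ext M m (annihilator L) -> size x = m -> size y = m ->
  (forall i, (i < m)%N -> nth 0 x i - nth 0 y i \in L) -> mapp f x = mapp f y.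
Proof.
move=> fL sx sy xy; move: f fL; apply: vspan_ind => [|a f g IHf IHg|].
- by rewrite !mapp0.
- by rewrite !mapp_linear IHf IHg.
move=> _ [phi [t [phiL ->]]]; rewrite !wedget_nthE //.
congr (\det _ *: _); apply/matrixP => i j; rewrite !mxE.
have /annihilatorP /subvP /(_ _ (xy j (ltn_ord j))) := phiL i.
by rewrite memv_ker linearB subr_eq0 (tnth_nth 0) => /eqP.
Qed.

(** Supplies a wedge with value 1 on a list that starts with [X]: the list is completed inside a
    complement of [L + <<X>>], and the covectors are dual to it. *)
Lemma dual_extend (R : realType) (U : vectType R) (L : {vspace U}) m X :
  free X -> (L :&: <<X>> = 0)%VS -> (size X <= m)%N ->
  (\dim L + m <= \dim {:U})%N ->
  exists (phi : m.-tuple 'Hom(U, R^o)) (Y : seq U),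
    [/\ forall i, tnth phi i \in annihilator L, size (X ++ Y) = m &
        \det (\matrix_(i < m, j < m) (nth 0 phi i (nth 0 (X ++ Y) j) : R)) = 1].
Proof.
move=> fX LX Xm mU; pose C := ((L + <<X>>)^C)%VS.
pose Y := take (m - size X) (vbasis C).
have YC : (<<Y>> <= C)%VS.
  by apply/span_subvP => y /mem_take /vbasis_mem.
have LXY : ((L + <<X>>) :&: <<Y>> = 0)%VS.
  by apply/eqP; rewrite -subv0 -(capv_compl (L + <<X>>)) capvS.
have sXY : size (X ++ Y) == m.
  rewrite size_cat size_takel ?subnKC // size_tuple dimv_compl dimv_disjoint_sum //.
  rewrite (eqnP fX) subnDA leq_sub2r // leq_subRL //.
  by apply: leq_trans mU; rewrite leq_addr.
have fXY : free (X ++ Y).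
  rewrite cat_free fX /=; apply/andP; split.
    apply: (@catl_free _ _ (drop (m - size X) (vbasis C))).
    by rewrite cat_take_drop (basis_free (vbasisP _)).
  apply/directv_addP/eqP; rewrite -subv0 -LXY capvS //.
  exact: addvSr.
have LXY' : (L :&: <<Tuple sXY>> = 0)%VS.
  apply/eqP; rewrite -subv0; apply/subvP => z; rewrite memv_cap /= span_cat.
  case/andP=> zL /memv_addP [x xX [y yY zE]].
  have y0 : y = 0.
    apply/eqP; rewrite -memv0 -LXY memv_cap yY andbT.
    by rewrite -(addKr x y) -zE addrC rpredB ?(subvP (addvSl _ _) _ zL) ?(subvP (addvSr _ _) _ xX).
  by rewrite -LX memv_cap zL zE y0 addr0.
have [phi [phiL phiE]] := dual_tuple (x := Tuple sXY) fXY LXY'.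
exists phi, Y; split=> //; first exact/eqP.
rewrite (_ : \matrix_(_, _) _ = 1%:M) ?det1 //.
by apply/matrixP => i j; rewrite !mxE -phiE !(tnth_nth 0).
Qed.

(** * The split exact sequence and lifts of decomposable forms to [W] *)

Section Splitting.
Variables (R : realType) (V W T : vectType R).
Variables (iota : 'Hom(V, W)) (prj : 'Hom(W, T)) (s : 'Hom(T, W)).
Hypotheses (hex : short_exact iota prj) (hs : (prj \o s)%VF = \1%VF).

Lemma prj_iota v : prj (iota v) = 0.
Proof.
have [_ ik _] := hex; apply/eqP; rewrite -memv_ker -ik.
exact/memv_img/memvf.
Qed.

Lemma prj_split t : prj (s t) = t.
Proof. by rewrite -comp_lfunE hs id_lfunE. Qed.

Lemma iotaK : cancel iota iota^-1%VF.
Proof. by have [k0 _ _] := hex; apply: lker0_lfunK; rewrite k0. Qed.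

Lemma split_mod w : w - s (prj w) \in limg iota.
Proof. by have [_ -> _] := hex; rewrite memv_ker linearB /= prj_split subrr. Qed.

Definition retract : 'Hom(W, V) := (iota^-1 \o (\1 - (s \o prj)%VF))%VF.

Lemma retract_iota v : retract (iota v) = v.
Proof.
by rewrite comp_lfunE add_lfunE opp_lfunE id_lfunE comp_lfunE prj_iota linear0
  subr0 iotaK.
Qed.

Lemma dim_extension : \dim {:W} = (\dim {:V} + \dim {:T})%N.
Proof.
have [k0 ik pT] := hex; rewrite -(limg_ker_dim prj) pT capfv -ik.
by rewrite limg_dim_eq // k0 capv0.
Qed.

Lemma dim_img_iota (L : {vspace V}) : \dim (iota @: L) = \dim L.
Proof. by have [k0 _ _] := hex; rewrite limg_dim_eq // k0 capv0. Qed.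

(** The covectors pulled back from [T] vanish on vertical vectors, so with [a] vertical arguments
    first the determinant is block triangular. *)
Lemma split_wedge k a b (phi : a.-tuple 'Hom(V, R^o)) (theta : b.-tuple 'Hom(T, R^o)) :
  (a + b)%N = k -> exists alpha : mform W R^o k,
  [/\ forall L : {vspace V}, (forall i, tnth phi i \in annihilator L) ->
        alpha \in ext R^o k (annihilator (iota @: L)),
      forall c, (a < c)%N -> contr0 (limg iota) c alpha &
      forall v y, size v = a -> size y = b ->
        mapp alpha (map iota v ++ y) =
        \det (\matrix_(i < a, j < a) (nth 0 phi i (nth 0 v j) : R)) *
        \det (\matrix_(i < b, j < b) (nth 0 theta i (prj (nth 0 y j)) : R))].
Proof.
move=> <- {k}.
pose psi := [tuple of map (fun f => f \o retract)%VF phi ++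
                      map (fun f => f \o prj)%VF theta].
have psil i : (i < a)%N -> nth 0 psi i = (nth 0 phi i \o retract)%VF.
  by move=> ia; rewrite nth_cat size_map size_tuple ia (nth_map 0) ?size_tuple.
have psir i : (i < b)%N -> nth 0 psi (a + i) = (nth 0 theta i \o prj)%VF.
  move=> ib; rewrite nth_cat size_map size_tuple ltnNge leq_addr /= addKn.
  by rewrite (nth_map 0) ?size_tuple.
exists (wedget psi (1 : R^o)); split.
- move=> L phiL; apply: mem_vspan; exists psi, (1 : R^o); split=> // i.
  apply/annihilatorP/subvP => _ /memv_imgP [v vL ->]; rewrite memv_ker (tnth_nth 0).
  case: (ltnP i a) => ia.
    rewrite psil // comp_lfunE retract_iota -memv_ker -(tnth_nth _ _ (Ordinal ia)).
    by have /annihilatorP /subvP -> := phiL (Ordinal ia).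
  rewrite -(subnKC ia) psir ?comp_lfunE ?prj_iota ?linear0 //.
  by rewrite ltn_subLR.
- move=> c ac; apply: mapp_contr0 => x y xV sx sxy.
  rewrite wedget_nthE ?size_cat // (@det_ublock_fun _ a b
    (fun i j => nth 0 psi i (nth 0 (x ++ y) j))) => [|i j].
    (* Argument number [a] is still vertical, so the first column of the lower right block is
       zero. *)
    have b0 : (0 < b)%N by rewrite -(ltn_add2l a) addn0 -sxy sx ltn_addr.
    rewrite (det_col0 (A := \matrix_(i < b, j < b) _) (j := Ordinal b0)) ?mulr0 ?scale0r //.
    move=> i; rewrite mxE psir //= addn0 nth_cat sx ac comp_lfunE.
    have /xV /memv_imgP [v _ ->] : nth 0 x a \in x by rewrite mem_nth ?sx.
    by rewrite prj_iota linear0.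
  case/andP=> ai iab ja; rewrite -(subnKC ai) psir ?ltn_subLR //.
  have jc := ltn_trans ja ac; rewrite nth_cat sx jc comp_lfunE.
  have /xV /memv_imgP [v _ ->] : nth 0 x j \in x by rewrite mem_nth ?sx.
  by rewrite prj_iota linear0.
move=> v y sv sy; rewrite wedget_nthE ?size_cat ?size_map ?sv ?sy //.
rewrite (@det_ublock_fun _ a b (fun i j => nth 0 psi i (nth 0 (map iota v ++ y) j))).
  rewrite -[LHS]/(_ * _ * 1 : R) mulr1.
  congr (_ * _); congr (\det _); apply/matrixP => i j; rewrite !mxE.
    by rewrite psil // nth_cat size_map sv ltn_ord (nth_map 0) ?sv // comp_lfunE retract_iota.
  by rewrite psir // nth_cat size_map sv ltnNge leq_addr /= addKn comp_lfunE.
move=> i j /andP [ai iab] ja; rewrite -(subnKC ai) psir ?ltn_subLR //.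
by rewrite nth_cat size_map sv ja (nth_map 0) ?sv // comp_lfunE prj_iota linear0.
Qed.
End Splitting.

(** * Values of the symbol *)

Section SymbolForm.
Variables (R : realType) (V W T : vectType R).
Variables (iota : 'Hom(V, W)) (prj : 'Hom(W, T)) (s : 'Hom(T, W)).
Hypotheses (hex : short_exact iota prj) (hs : (prj \o s)%VF = \1%VF).
Variables (k r : nat) (omega : mform W R^o k.+1).
Hypotheses (rk : (r <= k)%N).
Hypothesis homega : omega \in horform R^o (limg iota) k.+1 r.+1.

(** The horizontality degree; in this section the symbol has degree [r.+1], so its contractions have
    degree [r]. *)
Let q := (k.+1 - r.+1)%N.
Let altT := altform T R^o q.
Let omegahat : mform V (subvs_of altT) r.+1 := symbol iota s r.+1 omega.

Lemma horform_alternating : alternating omega.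
Proof. by have /horformP [] := homega. Qed.

Lemma mapp_symbol x y : size x = r.+1 -> size y = q ->
  mapp (vsval (mapp omegahat x)) y = mapp omega (map iota x ++ map s y).
Proof.
move=> /eqP sx /eqP sy.
exact: (@symbolE _ _ _ _ iota s k r.+1 omega (Tuple sx) (Tuple sy) rk horform_alternating).
Qed.

Lemma symbol_eq x t : size x = r.+1 ->
  (forall y, size y = q -> mapp omega (map iota x ++ map s y) = mapp (vsval t) y) ->
  mapp omegahat x = t.
Proof.
move=> sx xt; apply: subvs_inj; apply: mform_ext => y sy.
by rewrite mapp_symbol // xt.
Qed.

Lemma mapp_symbol0 x : size x = r.+1 ->
  (forall y, size y = q -> mapp omega (map iota x ++ map s y) = 0) ->
  mapp omegahat x = 0.
Proof. by move=> sx x0; apply: symbol_eq => // y sy; rewrite x0 // mapp0. Qed.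

Lemma symbol_alternating : alternating omegahat.
Proof.
move=> x ux; apply: mapp_symbol0 => [|y sy]; first exact: size_tuple.
apply: (alternating_nuniq horform_alternating).
  by rewrite size_cat !size_map size_tuple sy subnKC.
by rewrite cat_uniq; apply: contra ux => /and3P [/map_uniq].
Qed.

Lemma kerform_symbol v :
  iota v \in kerform omega -> v \in kerform omegahat.
Proof.
rewrite !memv_ker => /eqP ov; apply/eqP; apply: mform_ext => x sx.
rewrite mapp0; apply: (mapp_symbol0 (x := v :: x)) => [|y sy]; first by rewrite /= sx.
by rewrite /= -[omega _]/(flat omega (iota v)) ov mapp0.
Qed.

(** * The symbol is polylagrangian *)

Variables (N : nat) (L : {vspace V}).
Hypothesis hL : multilagrangian_subspace iota r.+1 omega N L.

Lemma flat_multilagrangian v : v \in L ->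
  flat omega (iota v) \in ext R^o k (annihilator (iota @: L)).
Proof.
move=> vL; have [_ E] := hL.
have : flat omega (iota v) \in (flat omega @: (iota @: L))%VS by rewrite !memv_img.
by rewrite E memv_cap => /andP [].
Qed.

Lemma multilagrangian_onto alpha :
  alpha \in ext R^o k (annihilator (iota @: L)) ->
  alpha \in horform R^o (limg iota) k r ->
  exists2 v, v \in L & flat omega (iota v) = alpha.
Proof.
move=> aL ah; have [_ E] := hL.
have : alpha \in (flat omega @: (iota @: L))%VS.
  by rewrite E memv_cap aL.
by case/memv_imgP => _ /memv_imgP [v vL ->] ->; exists v.
Qed.

Lemma symbol_polylagrangian : polylagrangian_subspace omegahat N L.
Proof.
have [dL _] := hL; split=> //; apply/eqP; rewrite eqEsubv; apply/andP; split.
  apply/subvP => _ /memv_imgP [v vL ->]; apply: killed_ext.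
    exact: alternating_flat symbol_alternating.
  move=> u uL; apply: flat_eq0 => x sx.
  apply: (mapp_symbol0 (x := v :: u :: x)) => [|y sy]; first by rewrite /= sx.
  have [af kf] := ext_killed (flat_multilagrangian vL).
  apply: (mapp_killed (x := [::]) af kf); last exact: memv_img.
  by rewrite /= add0n size_cat !size_map sy -addSn sx subnKC.
apply: vspan_subP => _ [phi [t [phiL ->]]].
(* Coefficients are sums of wedges, being alternating and killed by the zero subspace, so by
   linearity only decomposable ones have to be lifted. *)
have vsprojE h : h \in ext R^o q (annihilator 0%VS) ->
    wedget phi (vsproj altT h) \in (flat omegahat @: L)%VS.
  move: h; apply: vspan_ind => [|a f g fL gL|_ [theta [a [_ ->]]]].
  - by rewrite linear0 (linear_fun0 (@wedget_linear _ _ _ _ phi)) mem0v.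
  - by rewrite linearP wedget_linear rpredD ?rpredZ.
  have [alpha [aL ca aE]] := split_wedge s hex phi theta (subnKC rk).
  have {}aL := aL _ phiL; have [aa _] := ext_killed aL.
  have ah : alpha \in horform R^o (limg iota) k r by apply/horformP; split; last exact: ca.
  (* [alpha] has coefficient 1, so the scalar [a] of the wedge of [theta] is restored here. *)
  have [||v vL vE] := @multilagrangian_onto (a *: alpha); try exact: rpredZ.
  suff -> : wedget phi (vsproj altT (wedget theta a)) = flat omegahat v by apply: memv_img.
  apply: mform_ext => x sx; rewrite wedget_nthE //.
  apply/esym/(symbol_eq (x := v :: x)) => [|y sy]; first by rewrite /= sx.
  have wT : wedget theta a \in altT.
    apply/altformP; apply: (proj1 (ext_killed (L := 0%VS) _)).
    apply: mem_vspan; exists theta, a; split=> // i.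
    by apply/annihilatorP; apply: sub0v.
  rewrite linearZ /= vsprojK //.
  rewrite -[LHS]/(mapp (flat omega (iota v)) (map iota x ++ map s y)) vE.
  rewrite !mappZ aE ?size_map // wedget_nthE //.
  rewrite (_ : \det (\matrix_(i < q, j < q) nth 0 theta i (prj (nth 0 (map s y) j)))
     = \det (\matrix_(i < q, j < q) (nth 0 theta i (nth 0 y j) : R))); last first.
    congr (\det _); apply/matrixP => i j; rewrite !mxE (nth_map 0) ?sy //.
    by rewrite (prj_split hs).
  rewrite -[LHS]/(a * (_ * _) : R) -[RHS]/(_ * (_ * a) : R).
  by rewrite mulrC mulrA.
rewrite -(vsvalK t); apply: vsprojE; apply: killed_ext.
  by apply/altformP; apply: subvsP.
by move=> u; rewrite memv0 => /eqP ->; rewrite linear0.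
Qed.

(** The two bounds leave room for wedges on [V] and on [T] with value 1; their product is a nonzero
    contraction of the symbol. *)
Lemma symbol_neq0 : (q <= \dim {:T})%N -> (r <= N)%N -> omegahat != 0.
Proof.
move=> qT rN; have [dL E] := symbol_polylagrangian.
have cap0 (U : vectType R) (A : {vspace U}) : (A :&: <<[::]>> = 0)%VS.
  by rewrite span_nil capv0.
have [|theta [z [_ sz dz]]] :=
    dual_extend (m := q) (nil_free T) (cap0 T 0%VS) (leq0n _).
  by rewrite dimv0.
have [|phi [x [phiL sx dx]]] := dual_extend (m := r) (nil_free V) (cap0 V L) (leq0n _).
  by rewrite -dL leq_add2l.
rewrite /= in sz dz sx dx.
have wT : wedget theta (1 : R^o) \in altT.
  apply/altformP; apply: (proj1 (ext_killed (L := 0%VS) _)).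
  apply: mem_vspan; exists theta, 1; split=> // i.
  by apply/annihilatorP; apply: sub0v.
apply/eqP => o0.
have : wedget phi (vsproj altT (wedget theta (1 : R^o))) \in (flat omegahat @: L)%VS.
  by rewrite E; apply: mem_vspan; exists phi, (vsproj altT (wedget theta (1 : R^o))).
case/memv_imgP => v _; rewrite o0 /= lfunE /= => /(congr1 (fun f => mapp f x)).
rewrite wedget_nthE // dx scale1r mapp0 => /(congr1 vsval).
rewrite vsprojK // linear0 => /(congr1 (fun f => mapp f z)).
rewrite wedget_nthE // dz scale1r mapp0 => /eqP.
by rewrite oner_eq0.
Qed.

(** * The kernel of [omega] is vertical *)

Lemma multilagrangian_dim : omega != 0 -> (k <= N + \dim {:T})%N.
Proof.
move=> o0; rewrite leqNgt; apply: contra o0 => kN; apply/eqP.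
have [dL _] := hL.
have dW : (\dim {:W} < \dim (iota @: L) + k)%N.
  by rewrite (dim_extension hex) (dim_img_iota hex) -dL -addnA ltn_add2l.
apply: (alternating_gt_codim (L := (iota @: L)%VS)) horform_alternating _.
  by rewrite addnS ltnS ltnW.
move=> _ /memv_imgP [v vL ->].
have [] := ext_killed (flat_multilagrangian vL).
exact: alternating_gt_codim.
Qed.

(** The test [k]-form needs a slot for a covector from [T], hence [0 < k], unless [T] is zero and
    every vector is vertical. *)
Lemma kerform_vertical : omega != 0 -> (0 < k)%N || (\dim {:T} == 0)%N ->
  (q <= \dim {:T})%N -> (kerform omega <= limg iota)%VS.
Proof.
move=> o0 kT qT; apply/subvP => w wo; have [_ ik _] := hex.
rewrite ik memv_ker; apply: contraT => pw.
have T1 : (0 < \dim {:T})%N.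
  by rewrite -[1%N]/(true : nat) -pw -dim_vline dimvS ?subvf.
have k1 : (0 < k)%N by move: kT; rewrite [X in _ || X]eqn0Ngt T1 orbF.
have kN := multilagrangian_dim o0; have [dL _] := hL.
(* a covectors from V and k - a >= 1 from T: this must fit in N, r and dim T. *)
pose a := minn N (minn r k.-1).
have aN : (a <= N)%N by apply: geq_minl.
have ar : (a <= r)%N by rewrite (leq_trans (geq_minr _ _)) ?geq_minl.
have ak : (a < k)%N.
  by rewrite -[X in (_ < X)%N](prednK k1) ltnS (leq_trans (geq_minr _ _)) ?geq_minr.
(* One bound for each entry of the minimum: [k <= N + \dim {:T}], [k - r <= \dim {:T}] and
   [1 <= \dim {:T}]. *)
have bT : (k - a <= \dim {:T})%N.
  rewrite leq_subLR addn_minl leq_min kN addn_minl leq_min -leq_subLR qT /=.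
  by rewrite -(prednK k1) /= -[X in (X <= _)%N]addn1 leq_add2l.
(* The list on [T] starts with [prj w], so that the factor from [T] detects [w]. *)
have Lw : (0 :&: <<[:: prj w]>> = 0 :> {vspace T})%VS by rewrite cap0v.
have fw : free [:: prj w] by rewrite seq1_free.
have [||theta [z [_ sz dz]]] := dual_extend (m := (k - a)%N) fw Lw.
- by rewrite subn_gt0.
- by rewrite dimv0.
have Lv : (L :&: <<[::]>> = 0)%VS by rewrite span_nil capv0.
have [||phi [x [phiL sx dx]]] := dual_extend (m := a) (nil_free V) Lv.
- exact: leq0n.
- by rewrite -dL leq_add2l.
rewrite /= in dx sx.
have [alpha [aL ca aE]] := split_wedge s hex phi theta (subnKC (ltnW ak)).
have {}aL := aL _ phiL; have [aa _] := ext_killed aL.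
have [v vL vE] : exists2 v, v \in L & flat omega (iota v) = alpha.
  by apply: multilagrangian_onto aL _; apply/horformP; split=> //; apply: ca.
(* This value of [alpha] is 1, yet it is a value of [omega] with [w] among the arguments, hence
   0. *)
have := aE x (w :: map s z) sx; rewrite /= size_map => /(_ sz).
rewrite -vE dx mul1r (_ : \matrix_(_, _) _ =
    \matrix_(i < k - a, j < k - a) (nth 0 theta i (nth 0 (prj w :: z) j) : R)); last first.
  apply/matrixP => i j; rewrite !mxE; case: j => [[|j] jk] //=.
  rewrite (nth_map 0) ?(prj_split hs) //.
  by move: jk; rewrite -{1}sz.
rewrite dz => /eqP; rewrite -[X in X == _]/(mapp omega ((iota v :: map iota x) ++ w :: map s z)).
rewrite (@mapp_killed _ _ _ (kerform omega)) ?(eq_sym 0) ?oner_eq0 //.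
- exact: horform_alternating.
- by move=> u; rewrite memv_ker => /eqP.
- by rewrite /= !size_map sx; move: sz => /= sz; rewrite -addnS sz addSn subnKC // ltnW.
Qed.

Lemma kerform_sub_symbol : (kerform omega <= limg iota)%VS ->
  (kerform omega <= iota @: kerform omegahat)%VS.
Proof.
move=> /subvP kV; apply/subvP => w wo; have /memv_imgP [v _ wE] := kV _ wo.
by rewrite wE memv_img // kerform_symbol // -wE.
Qed.
End SymbolForm.

(** * The dimension bound in the multipresymplectic case *)

Lemma dim_kerform_symbol (R : realType) (V W T : vectType R)
    (iota : 'Hom(V, W)) (prj : 'Hom(W, T)) (s : 'Hom(T, W)) k
    (omega : mform W R^o k.+2) :
  short_exact iota prj -> (prj \o s)%VF = \1%VF -> \dim {:T} = k.+1 ->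
  omega \in horform R^o (limg iota) k.+2 2 ->
  (\dim (kerform (symbol iota s 2 omega)) <= \dim (kerform omega) + 1)%N.
Proof.
move=> hex hs dT oh; have [ao co] := (horformP _ _ _).1 oh.
set K := kerform _.
pose b := map s (vbasis {:T}).
have sb : size b == k.+1 by rewrite size_map size_tuple dT.
have glin : linear (fun v => mapp (flat omega (iota v)) b : R^o).
  by move=> a u v; rewrite -mapp_linear !linearP.
(* The one linear equation: the value of the contracted form on a lifted basis of [T]. *)
pose g := linfun (HB.pack (fun v => mapp (flat omega (iota v)) b : R^o)
  (GRing.isLinear.Build _ _ _ _ _ glin) : {linear V -> R^o}).
have Kg : (iota @: (K :&: lker g) <= kerform omega)%VS.
  apply/subvP => _ /memv_imgP [v /[!memv_cap] /andP [vK vg] ->].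
  rewrite memv_ker; apply/eqP.
  have av := alternating_flat (iota v) ao.
  (* A third vertical contraction vanishes by horizontality, so after two the arguments may be moved
     to the image of [s]; there the value is that of the symbol at [v, u], zero for [v] in [K]. *)
  have kv : killed (limg iota) (omega (iota v) : mform W R^o k.+1).
    move=> _ /memv_imgP [u _ ->].
    have au := alternating_flat (iota u) av.
    have ku : killed (limg iota) (omega (iota v) (iota u) : mform W R^o k).
      move=> z zV; apply: flat_eq0 => x sx.
      apply: (contr0_mapp (x := [:: iota v; iota u; z]) (y := x) co) => //=.
        by move=> w; rewrite !inE => /or3P [] /eqP -> //; apply/memv_img/memvf.
      by rewrite -sx.
    apply: mform_ext => x sx; rewrite mapp0.
    rewrite -[LHS]/(mapp (omega (iota v) (iota u) : mform W R^o k) x).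
    rewrite (mapp_mod (y := map s (map prj x)) (killed_ext au ku)) ?size_map //.
      have sx2 : size (map prj x) = (k.+2 - 2)%N by rewrite size_map sx !subSS subn0.
      have := mapp_symbol s (r := 1) (isT : (1 <= k.+1)%N) oh
        (x := [:: v; u]) (erefl _) sx2.
      move: vK; rewrite memv_ker => /eqP /(congr1 (fun h : mform V _ 1 => h u)).
      by rewrite /= lfunE /= => ->; rewrite linear0 mapp0.
    move=> i ik'; rewrite -map_comp (nth_map 0) ?sx //=.
    exact: (split_mod hex hs).
  (* The degree is [\dim {:T}], so a form killed by vertical vectors is determined by its value on
     [b]. *)
  apply: (alternating_eq0 (L := limg iota) (e := Tuple sb)) av kv _; last first.
    by move: vg; rewrite memv_ker lfunE => /eqP.
  apply/eqP; rewrite eqEsubv subvf; apply/subvP => w _ /=.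
  rewrite -[w](subrK (s (prj w))) memv_add ?(split_mod hex hs) //.
  by rewrite -limg_span memv_img // (span_basis (vbasisP _)) memvf.
(* Rank and nullity of [g] on [K], whose image lies in a line. *)
rewrite -(limg_ker_dim g K) leq_add //.
  by rewrite -(dim_img_iota hex) dimvS.
apply: leq_trans (dimvS (subvf _)) _.
by rewrite dimvf.
Qed.

(** * Assembly *)

Unset Implicit Arguments.

Theorem theorem4 (R : realType) (V W T : vectType R)
  (iota : 'Hom(V, W)) (prj : 'Hom(W, T)) (s : 'Hom(T, W)) (n k r N : nat)
  (omega : mform W R^o k.+1) (L : {vspace V})
  (hex : short_exact iota prj) (hs : (prj \o s)%VF = \1%VF)
  (hn : \dim {:T} = n)
  (hr : (1 <= r <= k.+1)%N) (hkr : (k.+1 - r <= n)%N)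
  (homega : omega \in horform R^o (limg iota) k.+1 r)
  (homega0 : omega != 0)
  (hL : multilagrangian_subspace iota r omega N L) :
  let omegahat := symbol iota s r omega in
  [/\ polylagrangian_subspace omegahat N L,
      (r.-1 <= N)%N -> polylagrangian omegahat N,
      (0 < k)%N || (n == 0)%N ->
        (kerform omega <= iota @: kerform omegahat)%VS &
      multipresymplectic iota r omega N n ->
        ((r.-1 <= N)%N -> polypresymplectic omegahat N) /\
        (\dim (kerform omegahat) - \dim (kerform omega) <= 1)%N].
Proof.
(* From here on [r] stands for the degree of the symbol minus one. *)
case: r hr hkr homega hL => // r /= rk hkr oh hL; subst n; rewrite ltnS in rk.
have P1 := symbol_polylagrangian hex hs rk oh hL.
(* The bound makes the exterior power of the annihilator of [L] nonzero, which gives nonvanishing of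
   the symbol. *)
have P2 : (r <= N)%N -> polylagrangian (symbol iota s r.+1 omega) N.
  move=> rN; split; last by exists L.
    by apply/altformP; apply: symbol_alternating rk oh.
  exact: (symbol_neq0 hex hs rk oh hL hkr rN).
split=> // [kT|[_ kn r1]].
  have kV := kerform_vertical hex hs oh hL homega0 kT hkr.
  exact: (kerform_sub_symbol s rk oh kV).
split=> [rN|]; first by split; [apply: P2|rewrite r1].
(* A symbol of degree 2 forces [k] to be positive, so [k] can be replaced by a successor. *)
case: r1 => r1; subst r; case: k omega kn rk oh {homega0 hkr hL P1 P2} => // k omega kn _ oh.
by rewrite leq_subLR; apply: (dim_kerform_symbol hex hs (esym kn) oh).
Qed.
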